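(* For every $n\ge1$ and every $\pi\in\mathrm{NCCP}(n;312)$, $$(\psi\circ\phi^{-1})(\alpha(\pi))=\overline{\pi}=\alpha'\big((\psi\circ\phi^{-1})(\pi)\big),$$ i.e. the square formed by $\alpha:\mathrm{NCCP}(n;312)\to\mathrm{NCCP}(n;312)$, $\alpha':\mathrm{NCP}(n)\to\mathrm{NCP}(n)$ and the two vertical maps $\psi\circ\phi^{-1}:\mathrm{NCCP}(n;312)\to\mathrm{NCP}(n)$, together with its diagonal $\pi\mapsto\overline\pi$ from the upper left $\mathrm{NCCP}(n;312)$ to the lower right $\mathrm{NCP}(n)$, is commutative.
   Context: **Noncommutative crossing partitions.** Let $[n]=\{1,\dots,n\}$. A noncommutative crossing partition of $[n]$ is a finite sequence $\pi=(\pi_1,\dots,\pi_l)$, written $\pi_1/\cdots/\pi_l$, of nonempty blocks such that each $p\in[n]$ appears exactly once, each block is written increasingly, and $\max(\pi_i)>\min(\pi_{i+1})$ for $1\le i\le l-1$. $\mathrm{NCCP}(n)$ is the set of these. Concatenating the blocks gives a permutation of $[n]$ in one-line notation which determines $\pi$ (slashes sit exactly at the descents); $\pi$ is identified with this permutation. For a pattern $\sigma\in\{312,132\}$, $\mathrm{NCCP}(n;\sigma)$ is the subset of those $\pi$ whose permutation avoids $\sigma$. $\mathrm{NCP}(n)$ is the set of $\pi\in\mathrm{NCCP}(n)$ that are non-crossing (no $a<b<c<d$ and $i\neq j$ with $a,c\in\pi_i$, $b,d\in\pi_j$) and canonical ($\min(\pi_l)<\cdots<\min(\pi_1)$). One has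 $\mathrm{NCP}(n)=\mathrm{NCCP}(n;132)$. **Maps $\phi$ and $\psi$.** A labeled binary tree with $n$ nodes is a rooted tree in which each node has at most one left child and at most one right child, labeled bijectively by $[n]$ with labels increasing from root to leaves. $\phi$ sends such a tree to the permutation obtained by reading labels in in-order (left subtree, root, right subtree); it is a bijection onto $\mathrm{NCCP}(n)$. $\psi$ sends such a tree to the canonical partition obtained by deleting all left edges, taking the labels of each resulting chain of right edges as a block, and arranging blocks with decreasing minima. The map $\psi\circ\phi^{-1}$ restricts to a bijection $\mathrm{NCCP}(n;312)\to\mathrm{NCP}(n)$; write $\phi\circ\psi^{-1}:\mathrm{NCP}(n)\to\mathrm{NCCP}(n;312)$ for its inverse. **Bar and $\alpha$.** For $\pi\in\mathrm{NCCP}(n)$, $\overline\pi$ is obtained by replacing each letter $i$ of the one-line notation of $\pi$ by $n+1-i$ (slashes are re-inserted at descents). E.g. $\overline{15/46/23}=6/23/15/4$. Bar maps $\mathrm{NCCP}(n;312)$ bijectively to $\mathrm{NCCP}(n;132)=\mathrm{NCP}(n)$. Define $\alpha(\pi)=(\phi\circ\psi^{-1})(\overline\pi)$ for $\pi\in\mathrm{NCCP}(n;312)$. **The map $\alpha'$ (Simion–Ullman involution).** Place points $1,2,\dots,n$ clockwise on a circle. Insert a new point between each pair of cyclically consecutive points; the one between $n$ and $1$ is labeled $1'$ and the remaining ones are labeled $2',3',\dots,n'$ going counterclockwise (so $i'$ lies between $n+1-i$ and $n+2-i$ for $2\le i\le n$). For $\pi\in\mathrm{NCP}(n)$, draw the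 convex hulls of its blocks in the disc; $i'$ and $j'$ are in the same block of $\alpha'(\pi)$ iff they lie in the same region of the complement. Dropping primes and arranging the blocks in canonical order gives $\alpha'(\pi)\in\mathrm{NCP}(n)$. E.g. $\alpha'(5/3/124)=5/34/12$. *)

(* Defs.v *)
From mathcomp Require Import all_boot all_order all_algebra.
From mathcomp Require Import all_classical all_reals all_analysis.
Import Order.TTheory GRing.Theory Num.Theory.
Import numFieldNormedType.Exports.

Set Implicit Arguments.
Unset Strict Implicit.
Unset Printing Implicit Defensive.

Local Open Scope classical_set_scope.
Local Open Scope nat_scope.

(* Blocks are lists over {1, ..., n} written increasingly, so their minimum and
   maximum are their first and last entries. *)
Definition block := seq nat.
Definition bmin (b : block) : nat := head 0 b.
Definition bmax (b : block) : nat := last 0 b.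

Definition NCCP (n : nat) : set (seq block) :=
  [set p | [/\ perm_eq (flatten p) (iota 1 n),
               forall b, b \in p -> b <> [::] /\ sorted ltn b
             & sorted (fun b c => bmin c < bmax b) p]].

Definition order_isomorphic (s t : seq nat) : Prop :=
  size s = size t /\
  forall i j, i < size s -> j < size s ->
    (nth 0 s i < nth 0 s j) = (nth 0 t i < nth 0 t j).

Definition avoids (s w : seq nat) : Prop :=
  forall u, subseq u w -> ~ order_isomorphic u s.

Definition NCCP_avoiding (n : nat) (s : seq nat) : set (seq block) :=
  [set p | NCCP n p /\ avoids s (flatten p)].

(* [cut_descents w] inserts a slash at each descent of the word [w]; on
   [NCCP n] it is inverse to [flatten], which gives the one-line notation. *)
Fixpoint cut_descents (w : seq nat) : seq block :=
  if w is x :: w' then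
    match cut_descents w' with
    | (y :: b) :: p => if x < y then (x :: y :: b) :: p
                       else [:: x] :: (y :: b) :: p
    | _ => [:: [:: x]]
    end
  else [::].

Definition canonical_order (p : seq block) : seq block :=
  sort (fun b c => bmin c <= bmin b) p.

(* Binary trees; [Leaf] is the empty tree, that is, an absent child. *)
Inductive btree := Leaf | Node of btree & nat & btree.

Fixpoint inorder (t : btree) : seq nat :=
  if t is Node l x r then inorder l ++ x :: inorder r else [::].

Fixpoint increasing (t : btree) : bool :=
  if t is Node l x r then
    [&& all (ltn x) (inorder l), all (ltn x) (inorder r),
        increasing l & increasing r]
  else true.

Definition labeled_trees (n : nat) : set btree :=
  [set t | perm_eq (inorder t) (iota 1 n) /\ increasing t].

Definition phi (t : btree) : seq block := cut_descents (inorder t).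

(* The chains of right edges left after deleting all left edges; the chain
   through the root comes first. *)
Fixpoint right_chains (t : btree) : seq block :=
  if t is Node l x r then
    (x :: head [::] (right_chains r))
      :: right_chains l ++ behead (right_chains r)
  else [::].

Definition psi (t : btree) : seq block := canonical_order (right_chains t).

(* Inverses are the library's ['pinv_ d A f], the inverse of [f] restricted to
   [A]; the default [d] is the value outside the image of [A]. *)
Definition phi_inv (n : nat) : seq block -> btree :=
  'pinv_(fun=> Leaf) (labeled_trees n) phi.

Definition psi_phi_inv (n : nat) : seq block -> seq block := psi \o phi_inv n.

Definition phi_psi_inv (n : nat) : seq block -> seq block :=
  'pinv_(fun=> [::]) (NCCP_avoiding n [:: 3; 1; 2]) (psi_phi_inv n).

Definition bar (n : nat) (p : seq block) : seq block :=
  cut_descents [seq n.+1 - i | i <- flatten p].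

Definition alpha (n : nat) (p : seq block) : seq block :=
  phi_psi_inv n (bar n p).

Section SimionUllman.
Variable R : realType.
Local Open Scope ring_scope.

Notation plane := (R^o * R^o)%type.

(* [circle_point n k] is the [k]-th of [2 * n] equally spaced points, clockwise.
   Clockwise from [1], the points are 1, n', 2, (n-1)', ..., 2', n, 1'. *)
Definition circle_point (n k : nat) : plane :=
  let t := k%:R * pi / n%:R in (cos t, - sin t).

Definition vertex (n i : nat) : plane := circle_point n (i.-1).*2.

Definition primed_vertex (n i : nat) : plane := circle_point n ((n - i).*2.+1).

Definition disc : set plane := [set z | z.1 ^+ 2 + z.2 ^+ 2 <= 1].

Definition convex_hull (A : set plane) : set plane :=
  smallest (@convex_set R plane) A.

Definition hulls (n : nat) (p : seq block) : set plane :=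
  \bigcup_(b in [set` p]) convex_hull (vertex n @` [set` b]).

Definition same_region (n : nat) (p : seq block) (i j : nat) : Prop :=
  connected_component (disc `\` hulls n p) (primed_vertex n i)
    (primed_vertex n j).

Definition alpha' (n : nat) (p : seq block) : seq block :=
  canonical_order
    (undup [seq [seq j <- iota 1 n | `[< same_region n p i j >]]
           | i <- iota 1 n]).

End SimionUllman.

(* Main.v *)
(** A 312-avoiding partition is [phi t] for the tree [t] labelled in preorder:
    in a 312-avoiding in-order word [L x R] with minimum [x], every letter of [L]
    is smaller than every letter of [R].

    Such trees carry a reflection (relabel [i] as [n + 1 - i], rebuild the tree
    from right to left) whose chains of right edges, read backwards, are exactly
    the blocks of the bar of [phi t].  Hence the bar of [phi t] is
    [psi (reflection t)], which gives the first equality.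

    For the second one, write [a°] for the primed point just after the vertex
    [a].  If [a <= b], the points [a°] and [b°] lie in the same region iff no
    block meets both the interval [(a, b]] and its complement: if no block does,
    every hull lies strictly on one side of the line [a° b°], so the segment
    avoids all hulls; if a block does, it contains a chord separating [a°] from
    [b°].  An induction on [t] matches this criterion with the blocks of
    [psi (reflection t)]. *)

Require Import Defs.
From mathcomp Require Import all_boot all_order all_algebra.
From mathcomp Require Import all_classical all_reals all_analysis.
From mathcomp Require Import zify ring lra.
Import Order.TTheory GRing.Theory Num.Theory.
Import numFieldNormedType.Exports.

Set Implicit Arguments.
Unset Strict Implicit.
Unset Printing Implicit Defensive.

Local Open Scope classical_set_scope.
Local Open Scope nat_scope.

(** * Words and blocks *)

Lemma flatten_head_behead (q : seq block) :
  head [::] q ++ flatten (behead q) = flatten q.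
Proof. by case: q. Qed.

Lemma mem_head_flatten (q : seq block) x :
  x \in head [::] q -> x \in flatten q.
Proof. by case: q => //= b q xb; rewrite mem_cat xb. Qed.

Lemma uniq_flatten_inj (q : seq block) b b' x : uniq (flatten q) ->
  b \in q -> b' \in q -> x \in b -> x \in b' -> b = b'.
Proof.
elim: q => //= b0 q IH; rewrite cat_uniq => /and3P[_ /hasPn dis uq].
have out b1 : b1 \in q -> x \in b1 -> x \notin b0.
  by move=> b1q xb1; apply: dis; apply/flattenP; exists b1.
rewrite !inE => /predU1P[->|bq] /predU1P[->|b'q] //.
- by move=> xb /(out _ b'q); rewrite xb.
- by move=> /(out _ bq)/negP xb /xb.
- exact: IH.
Qed.

(** Strictly decreasing minima leave no ties, so the weakly sorted arrangement of these blocks is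
    unique. Only the set of blocks has to be known, which is how [psi] and [alpha'] get
    evaluated. *)
Lemma canonical_order_eq (s q : seq block) : uniq s ->
  sorted (fun b c => bmin c < bmin b) q -> s =i q -> canonical_order s = q.
Proof.
move=> us sq sqi.
have uq : uniq q.
  by apply: sorted_uniq sq => [y x z|x] /=; [lia | rewrite ltnn].
have sp : perm_eq s q by apply: uniq_perm.
set s' := canonical_order s.
have s's : perm_eq s' s by rewrite /s' /canonical_order perm_sort.
have us' : uniq (map bmin s').
  rewrite (perm_uniq (perm_map bmin (perm_trans s's sp))).
  apply: (@sorted_uniq _ gtn); [move=> y x z /=; lia|by move=> x /=; rewrite ltnn|].
  by rewrite sorted_map.
apply: (@irr_sorted_eq _ (fun b c => bmin c < bmin b)) => //.
- by move=> y x z /=; lia.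
- by move=> x /=; rewrite ltnn.
- have : sorted geq (map bmin s').
    by rewrite sorted_map; apply: sort_sorted => x y; exact: leq_total.
  by move=> sg; have := gtn_sorted_uniq_geq (map bmin s'); rewrite us' sg sorted_map.
- by move=> x; rewrite (perm_mem s's) sqi.
Qed.

(** Hence on a word of at least two letters [cut_descents] always reaches the comparison of [x] with
    [y]. *)
Lemma cut_descents_cons x w :
  exists b p, cut_descents (x :: w) = (x :: b) :: p.
Proof.
elim: w x => [|y w IH] x; first by exists [::], [::].
have [b [p /= ->]] := IH y.
by case: ifP => _; [exists (y :: b), p | exists [::], ((y :: b) :: p)].
Qed.

Lemma flatten_cut_descents w : flatten (cut_descents w) = w.
Proof.
elim: w => //= x [|y w] IH //.
have [b [p E]] := cut_descents_cons y w.
by move: IH; rewrite E => /= IH; case: ifP => _ /=; rewrite IH.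
Qed.

Lemma cut_descents_blocks w b :
  b \in cut_descents w -> b <> [::] /\ sorted ltn b.
Proof.
elim: w b => //= x [|y w] IH b; first by rewrite inE => /eqP->.
have [b0 [p E]] := cut_descents_cons y w; move: IH; rewrite E => IH.
have [_ sy] := IH (y :: b0) (mem_head _ _).
case: ifP => xy; rewrite inE => /predU1P[->|bp].
- by split=> //=; rewrite xy.
- by apply: IH; rewrite inE bp orbT.
- by [].
- exact: IH.
Qed.

Lemma cut_descents_descents w : uniq w ->
  sorted (fun b c => bmin c < bmax b) (cut_descents w).
Proof.
elim: w => //= x [|y w] IH // /andP[xw uw].
have [b0 [p E]] := cut_descents_cons y w; move: (IH uw); rewrite E /= => {}IH.
have xy : x != y by apply: contraNneq xw => ->; exact: mem_head.
case: ifP => xy1 /=.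
  by case: p IH {E} => [|b1 p].
by rewrite IH andbT /bmin /bmax /=; lia.
Qed.

Lemma cut_descents_flatten (q : seq block) :
  (forall b, b \in q -> b <> [::] /\ sorted ltn b) ->
  sorted (fun b c => bmin c < bmax b) q ->
  cut_descents (flatten q) = q.
Proof.
elim: q => // b q IH qb sq.
have {}IH : cut_descents (flatten q) = q.
  apply: IH => [c cq|]; first by apply: qb; rewrite inE cq orbT.
  exact: path_sorted sq.
have [b0 sb] := qb _ (mem_head _ _).
(* What the junction with the next block requires. It depends on [b] only through its last letter,
   so it survives the inner induction, which strips letters from the front of [b]. *)
have qh : forall c q', q = c :: q' -> bmin c < bmax b /\ c <> [::].
  move=> c q' qE; move: sq; rewrite qE /= => /andP[-> _]; split=> //.
  by have [] : c <> [::] /\ sorted ltn c by apply: qb; rewrite qE !inE eqxx orbT.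
elim: b b0 sb qh {qb sq} => // x b IHb _.
case: b IHb => [_ _|y b IHb /= /andP[xy yb]] qh /=.
  rewrite IH; case: q qh {IH} => // c q /(_ _ _ erefl)[].
  by case: c => // z c; rewrite /bmin /bmax /= => zx _; rewrite ltnNge ltnW.
have /= -> := IHb _ yb; first by rewrite xy.
by [].
by move=> c q' /qh.
Qed.

(** * Trees labelled in preorder *)

Fixpoint preorder (t : btree) : seq nat :=
  if t is Node l x r then x :: preorder l ++ preorder r else [::].

Lemma perm_inorder_preorder t : perm_eq (inorder t) (preorder t).
Proof.
elim: t => //= l IHl x r IHr.
by rewrite -cat1s perm_catCA /= perm_cons perm_cat.
Qed.

Lemma perm_right_chains t : perm_eq (flatten (right_chains t)) (preorder t).
Proof.
elim: t => //= l IHl x r IHr; rewrite perm_cons flatten_cat perm_catCA.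
by rewrite flatten_head_behead perm_cat.
Qed.

Lemma mem_right_chains t x : (x \in flatten (right_chains t)) = (x \in preorder t).
Proof. exact/perm_mem/perm_right_chains. Qed.

Lemma right_chains_neq0 t b : b \in right_chains t -> b <> [::].
Proof.
elim: t b => //= l IHl x r IHr b; rewrite inE mem_cat.
by case/or3P=> [/eqP->|/IHl|/mem_behead/IHr].
Qed.

(** The offset [k] is free so that both subtrees of such a tree qualify in inductions. *)
Definition preordered (k : nat) (t : btree) : Prop :=
  preorder t = iota k (size (preorder t)).

Lemma preordered_node k l x r : preordered k (Node l x r) ->
  [/\ x = k, preordered k.+1 l & preordered (k.+1 + size (preorder l)) r].
Proof.
rewrite /preordered /= size_cat iotaD => -[-> /eqP].
by rewrite eqseq_cat ?size_iota// => /andP[/eqP ? /eqP].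
Qed.

Lemma mem_preordered k t x : preordered k t ->
  (x \in preorder t) = (k <= x < k + size (preorder t)).
Proof. by move=> ->; rewrite mem_iota size_iota. Qed.

Lemma preordered_increasing k t : preordered k t -> increasing t.
Proof.
elim: t k => //= l IHl x r IHr k /preordered_node[-> pl pr].
rewrite (IHl _ pl) (IHr _ pr) !andbT; apply/andP; split; apply/allP => y;
  by rewrite (perm_mem (perm_inorder_preorder _))
    ?(mem_preordered _ pl) ?(mem_preordered _ pr) /=; lia.
Qed.

Lemma sorted_right_chain k t b : preordered k t ->
  b \in right_chains t -> sorted ltn b.
Proof.
elim: t k b => //= l IHl x r IHr k b /preordered_node[-> pl pr].
rewrite inE mem_cat => /or3P[/eqP->|/(IHl _ _ pl)|/mem_behead/(IHr _ _ pr)] //.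
rewrite /sorted path_sortedE; last exact: ltn_trans.
apply/andP; split.
  apply/allP => y /mem_head_flatten.
  by rewrite mem_right_chains (mem_preordered _ pr) /=; lia.
case E : (right_chains r) => [//|h q] /=.
by apply: (IHr _ _ pr); rewrite E mem_head.
Qed.

Lemma bmin_right_chains t : {subset map bmin (right_chains t) <= preorder t}.
Proof.
move=> _ /mapP[b bt ->]; rewrite -mem_right_chains; apply/flattenP.
exists b => //; have := right_chains_neq0 bt.
by case: b {bt} => // y b _; rewrite /bmin mem_head.
Qed.

(** The root chain comes first, then the chains of [l], then the remaining chains of [r]; root, [l]
    and [r] carry successive intervals of labels. *)
Lemma sorted_bmin_right_chains k t : preordered k t ->
  sorted ltn (map bmin (right_chains t)).
Proof.
elim: t k => //= l IHl x r IHr k /preordered_node[-> pl pr].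
rewrite path_sortedE; last exact: ltn_trans.
have br y : y \in map bmin (behead (right_chains r)) -> y \in preorder r.
  by rewrite -behead_map => /mem_behead/bmin_right_chains.
rewrite map_cat; apply/andP; split.
  rewrite all_cat; apply/andP; split; apply/allP => y.
    by move/bmin_right_chains; rewrite (mem_preordered _ pl) /bmin /=; lia.
  by move/br; rewrite (mem_preordered _ pr) /bmin /=; lia.
rewrite (sorted_pairwise ltn_trans) pairwise_cat -!(sorted_pairwise ltn_trans).
rewrite (IHl _ pl) /=; apply/andP; split.
  apply/allrelP => y z /bmin_right_chains yl /br zr.
  by move: yl zr; rewrite (mem_preordered _ pl) (mem_preordered _ pr); lia.
rewrite -behead_map; have := IHr _ pr.
by case: (map _ _) => //= y s /path_sorted.
Qed.

Lemma sorted_rev_right_chains k t : preordered k t ->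
  sorted (fun b c => bmin c < bmin b) (rev (right_chains t)).
Proof.
by move=> /sorted_bmin_right_chains; rewrite rev_sorted sorted_map.
Qed.

Lemma preordered_psi k t : preordered k t -> psi t = rev (right_chains t).
Proof.
move=> pt; apply: canonical_order_eq.
- have := sorted_bmin_right_chains pt; rewrite ltn_sorted_uniq_leq => /andP[+ _].
  exact: map_uniq.
- exact: sorted_rev_right_chains pt.
- by move=> b; rewrite mem_rev.
Qed.

(** If [c] follows [b] in the reversed list, then [bmin c < bmin b <= bmax b], so the block borders
    are descents. *)
Lemma preordered_cut_descents k t : preordered k t ->
  cut_descents (flatten (rev (right_chains t))) = rev (right_chains t).
Proof.
move=> pt; apply: cut_descents_flatten => [b|].
  rewrite mem_rev => bt; split; first exact: right_chains_neq0 bt.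
  exact: sorted_right_chain pt bt.
have := sorted_rev_right_chains pt.
have : forall b, b \in rev (right_chains t) -> bmin b <= bmax b.
  move=> b; rewrite mem_rev => bt.
  have := sorted_right_chain pt bt.
  case: b {bt} => // y b /= yb; rewrite /bmin /bmax /=.
  have := order_path_min ltn_trans yb.
  case/lastP: b {yb} => //= b z; rewrite last_rcons all_rcons => /andP[yz _].
  exact: ltnW.
elim: (rev _) => //= b [|c q] IH //= qb /andP[cb sq].
rewrite (leq_trans cb) ?qb ?mem_head//=.
by apply: IH => // d dq; apply: qb; rewrite inE dq orbT.
Qed.

(** * Avoidance of 312 and preorder labels *)

Lemma avoids312P w : avoids [:: 3; 1; 2] w <->
  forall a b c, subseq [:: a; b; c] w -> b < c -> c < a -> False.
Proof.
split=> [av a b c s bc ca|av u su [/= s3 iso]].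
  apply: (av _ s); split=> //= -[|[|[|i]]] [|[|[|j]]] //= _ _; lia.
case: u s3 iso su => [|a [|b [|c [|d u]]]] // _ iso su.
by apply: (av a b c su); [have := iso 1 2 isT isT|have := iso 2 0 isT isT] => /= ->.
Qed.

Lemma subseq_catP (T : eqType) (u s1 s2 : seq T) : subseq u (s1 ++ s2) ->
  exists u1 u2, [/\ u = u1 ++ u2, subseq u1 s1 & subseq u2 s2].
Proof.
elim: s1 u => [|x s1 IH] u; first by exists [::], u; rewrite sub0seq.
case: u => [_|y u]; first by exists [::], [::]; rewrite !sub0seq.
rewrite /=; case: eqP => [->|_] /IH[u1 [u2 [uE su1 su2]]].
  by exists (x :: u1), u2; rewrite uE /= eqxx.
exists u1, u2; split=> //; exact: subseq_trans su1 (subseq_cons _ _).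
Qed.

Lemma preordered_avoids k t : preordered k t -> avoids [:: 3; 1; 2] (inorder t).
Proof.
move=> pt; apply/avoids312P; elim: t k pt => //= l IHl x r IHr k.
move=> /preordered_node[-> pl pr] a b c /subseq_catP[u1 [u2 [uE s1 s2]]] bc ca.
have inl y : y \in u1 -> k < y <= k + size (preorder l).
  move/(mem_subseq s1); rewrite (perm_mem (perm_inorder_preorder _)).
  by rewrite (mem_preordered _ pl); lia.
have inr y : y \in u2 -> y = k \/ k + size (preorder l) < y.
  move/(mem_subseq s2); rewrite inE (perm_mem (perm_inorder_preorder _)).
  by rewrite (mem_preordered _ pr) => /predU1P[|]; [left|right; lia].
(* The root can only be the first letter of [u2]; the later ones lie in the right subtree. *)
have inr2 y : y \in behead u2 -> k + size (preorder l) < y.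
  case: u2 s2 {uE inr} => //= z u2; case: eqP => [_|_] s2 yu.
    move/(mem_subseq s2): yu; rewrite (perm_mem (perm_inorder_preorder _)).
    by rewrite (mem_preordered _ pr); lia.
  have: y \in z :: u2 by rewrite inE yu orbT.
  move/(mem_subseq s2); rewrite (perm_mem (perm_inorder_preorder _)).
  by rewrite (mem_preordered _ pr); lia.
(* Cases on how many letters of the occurrence lie in the left subtree. With none or all three it
   sits in one subtree, the root being too small to play [a]. With one, [c] is in [r] and exceeds
   [a]; with two, [c] is the root, below [b], or in [r], above [a]. *)
case: u1 uE s1 inl => [|a1 [|b1 [|c1 [|d1 u1]]]].
- move=> /= uE _ _; move: uE s2 inr inr2 => <- s2 inr inr2.
  have ak : a <> k.
    have := inr2 b; rewrite !inE eqxx => /(_ isT) kb ak; lia.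
  by apply: (IHr _ pr a b c) => //; move: s2 => /=; case: eqP.
- case=> aE uE _ inl; have := inr2 c; have := inl a1 (mem_head _ _).
  by rewrite -uE -aE !inE eqxx => ? /(_ isT); lia.
- case=> aE bE uE _ inl; have := inr c; have := inl a1; have := inl b1.
  by rewrite -uE -aE -bE !inE !eqxx orbT => /(_ isT) ? /(_ isT) ? /(_ isT); lia.
- by case=> <- <- <- _ s1 _; apply: (IHl _ pl a b c).
- by [].
Qed.

Lemma subseq3 (a b c : nat) s1 s2 : a \in s1 -> c \in s2 ->
  subseq [:: a; b; c] (s1 ++ b :: s2).
Proof.
move=> a1 c2; rewrite -[[:: a; b; c]]cat1s; apply: cat_subseq.
  by rewrite sub1seq.
by rewrite /= eqxx sub1seq.
Qed.

(** If [y] in the left subtree exceeded [z] in the right one, then [y], the root [x], [z] would form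
    a 312, since [x] is the minimum. *)
Lemma avoids_preorder_sorted t : uniq (inorder t) -> increasing t ->
  avoids [:: 3; 1; 2] (inorder t) -> sorted ltn (preorder t).
Proof.
move=> ut it /avoids312P; elim: t ut it => //= l IHl x r IHr.
rewrite cat_uniq => /and3P[ul /hasPn dis] /andP[_ ur].
move=> /and4P[xl xr il ir] av.
have {}IHl : sorted ltn (preorder l).
  apply: IHl => // a b c s; apply: av.
  exact: subseq_trans s (prefix_subseq _ _).
have {}IHr : sorted ltn (preorder r).
  apply: IHr => // a b c s; apply: av; apply: subseq_trans s _.
  by rewrite -cat_rcons suffix_subseq.
rewrite path_sortedE; last exact: ltn_trans.
rewrite all_cat -!(perm_all _ (perm_inorder_preorder _)) xl xr /=.
rewrite (sorted_pairwise ltn_trans) pairwise_cat -!(sorted_pairwise ltn_trans).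
rewrite IHl IHr !andbT; apply/allrelP => y z.
rewrite -!(perm_mem (perm_inorder_preorder _)) => yl zr.
have := dis z; rewrite inE zr orbT => /(_ isT) /= zl.
have yz : y != z by apply: contraNneq zl => <-.
have xz : x < z by move/allP: xr => /(_ _ zr).
have := av y x z (subseq3 _ yl zr) xz; lia.
Qed.

Lemma avoids_preordered k n t : perm_eq (inorder t) (iota k n) ->
  increasing t -> avoids [:: 3; 1; 2] (inorder t) -> preordered k t.
Proof.
move=> pt it av.
have ut : uniq (inorder t) by rewrite (perm_uniq pt) iota_uniq.
have st := avoids_preorder_sorted ut it av.
have pp : perm_eq (preorder t) (iota k n).
  by rewrite -(permPl (perm_inorder_preorder t)).
rewrite /preordered (perm_size pp) size_iota.
apply: (irr_sorted_eq ltn_trans ltnn st (iota_ltn_sorted _ _)).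
exact: perm_mem.
Qed.

(** * Increasing trees from words and the inverse of [phi] *)

(** Prepends [x] to the in-order word: [x] replaces the first larger node on the left spine and
    takes the subtree there as right child. *)
Fixpoint push_left (x : nat) (t : btree) : btree :=
  if t is Node l y r then
    if x < y then Node Leaf x t else Node (push_left x l) y r
  else Node Leaf x Leaf.

Lemma inorder_push_left x t : inorder (push_left x t) = x :: inorder t.
Proof. by elim: t => //= l IHl y r _; case: ifP => //= _; rewrite IHl. Qed.

Lemma increasing_push_left x t : x \notin inorder t -> increasing t ->
  increasing (push_left x t).
Proof.
elim: t => //= l IHl y r _; rewrite mem_cat inE !negb_or.
case/and3P=> xl xy xr /and4P[yl yr il ir]; case: ifP => xy' /=.
  rewrite yl yr il ir /= !andbT all_cat /= xy' /=.
  apply/andP; split; apply/allP => z /=; first by move/(allP yl) => /=; lia.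
  by move/(allP yr) => /=; lia.
rewrite inorder_push_left /= yl yr ir IHl// !andbT; lia.
Qed.

Lemma increasing_tree_exists w : uniq w ->
  exists t, inorder t = w /\ increasing t.
Proof.
elim: w => [|x w IH] /=; first by exists Leaf.
case/andP=> xw /IH[t [tw it]]; exists (push_left x t).
by rewrite inorder_push_left tw increasing_push_left ?tw.
Qed.

(** The root is the minimum of the word, and its position cuts the word into those of the two
    subtrees. *)
Lemma increasing_inorder_inj t1 t2 : uniq (inorder t1) ->
  increasing t1 -> increasing t2 -> inorder t1 = inorder t2 -> t1 = t2.
Proof.
elim: t1 t2 => [|l1 IHl x1 r1 IHr] [|l2 x2 r2] //=.
- by move=> _ _ _; case: (inorder l2).
- by move=> _ _ _; case: (inorder l1).
move=> u1 /and4P[a1 b1 il1 ir1] /and4P[a2 b2 il2 ir2] E.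
have x12 : x1 = x2.
  have x12 : x1 \in inorder l2 ++ x2 :: inorder r2.
    by rewrite -E mem_cat mem_head orbT.
  have x21 : x2 \in inorder l1 ++ x1 :: inorder r1.
    by rewrite E mem_cat mem_head orbT.
  move: x12 x21; rewrite !mem_cat !inE.
  case/or3P=> [/(allP a2)|/eqP //|/(allP b2)] /= h2;
  by case/or3P=> [/(allP a1)|/eqP //|/(allP b1)] /= h1; lia.
have s12 : size (inorder l1) = size (inorder l2).
  have i1 : index x1 (inorder l1 ++ x1 :: inorder r1) = size (inorder l1).
    rewrite index_cat /= eqxx addn0 ifN//.
    by apply/negP => /(allP a1) /=; rewrite ltnn.
  have i2 : index x2 (inorder l2 ++ x2 :: inorder r2) = size (inorder l2).
    rewrite index_cat /= eqxx addn0 ifN//.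
    by apply/negP => /(allP a2) /=; rewrite ltnn.
  by rewrite -i1 E x12 i2.
move: u1; rewrite cat_uniq /= => /and3P[ul _ /andP[_ ur]].
move/eqP: E; rewrite eqseq_cat // => /andP[/eqP El /eqP[_ Er]].
by rewrite (IHl l2)// (IHr r2)// x12.
Qed.

Lemma phi_inj n : {in labeled_trees n &, injective phi}.
Proof.
move=> t1 t2; rewrite !inE => -[p1 i1] [p2 i2] E.
apply: increasing_inorder_inj => //; first by rewrite (perm_uniq p1) iota_uniq.
by rewrite -[LHS]flatten_cut_descents -/(phi t1) E flatten_cut_descents.
Qed.

Lemma phi_invK n t : labeled_trees n t -> phi_inv n (phi t) = t.
Proof.
move=> tn; rewrite /phi_inv.
by apply: (pinvKV (fun=> Leaf) (@phi_inj n)); rewrite inE.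
Qed.

Lemma NCCP_phi n p : NCCP n p ->
  exists t, [/\ labeled_trees n t, inorder t = flatten p & phi t = p].
Proof.
move=> [pp pb ps].
have [t [tp it]] : exists t, inorder t = flatten p /\ increasing t.
  by apply: increasing_tree_exists; rewrite (perm_uniq pp) iota_uniq.
exists t; split=> //; first by split; rewrite ?tp.
by rewrite /phi tp cut_descents_flatten.
Qed.

Lemma preordered_labeled n t : preorder t = iota 1 n -> labeled_trees n t.
Proof.
move=> pt; split; first by rewrite -pt perm_inorder_preorder.
by apply: (@preordered_increasing 1); rewrite /preordered pt size_iota.
Qed.

Lemma phi_NCCP_avoiding n t : preorder t = iota 1 n ->
  NCCP_avoiding n [:: 3; 1; 2] (phi t).
Proof.
move=> pt; have [pi _] := preordered_labeled pt.
rewrite /NCCP_avoiding /= /phi flatten_cut_descents; split; last first.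
  by apply: (@preordered_avoids 1); rewrite /preordered pt size_iota.
split; first by rewrite flatten_cut_descents.
- by move=> b; exact: cut_descents_blocks.
- by apply: cut_descents_descents; rewrite (perm_uniq pi) iota_uniq.
Qed.

(** * Reflection of trees *)

(** Extends the chain through the root by one node, which becomes last in preorder. *)
Fixpoint attachR (t : btree) (y : nat) : btree :=
  if t is Node l x r then Node l x (attachR r y) else Node Leaf y Leaf.

(* Hangs [s] below the last node of [t] in preorder, so that preorders are
   concatenated. *)
Fixpoint attachL (t s : btree) : btree :=
  if t is Node l x r then
    if r is Leaf then Node (attachL l s) x Leaf else Node l x (attachL r s)
  else s.

(** The relabelling [c] is a parameter: [subn n.+1] gives the actual reflection, while [id] keeps
    the labels of [t] for comparison with its blocks. *)
Fixpoint reflection (c : nat -> nat) (t : btree) : btree :=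
  if t is Node l x r then
    attachL (reflection c r) (attachR (reflection c l) (c x))
  else Leaf.

Lemma preorder_attachR t y : preorder (attachR t y) = rcons (preorder t) y.
Proof. by elim: t => //= l _ x r ->; rewrite rcons_cat. Qed.

Lemma preorder_attachL t s : preorder (attachL t s) = preorder t ++ preorder s.
Proof.
elim: t => //= l IHl x r IHr; case: r IHr => [|l' y r'] IHr /=.
  by rewrite IHl !cats0.
by move: IHr => /= ->; rewrite -!catA /= -!catA.
Qed.

Lemma preorder_reflection c t :
  preorder (reflection c t) = rev (map c (preorder t)).
Proof.
elim: t => //= l IHl x r IHr.
by rewrite preorder_attachL preorder_attachR IHl IHr map_cat rev_cons rev_cat
  rcons_cat.
Qed.

Lemma right_chains_attachR t y : right_chains (attachR t y) =
  rcons (head [::] (right_chains t)) y :: behead (right_chains t).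
Proof. by elim: t => //= l _ x r ->. Qed.

(** When [t] is nonempty, [s] hangs by a left edge, whose deletion separates the chains of [t] from
    those of [s]; being below the last node of [t], the latter come last. *)
Lemma right_chains_attachL t s :
  right_chains (attachL t s) = right_chains t ++ right_chains s.
Proof.
elim: t => //= l IHl x r IHr; case: r IHr => [|l' y r'] IHr /=.
  by rewrite IHl !cats0.
by move: IHr => /= ->; rewrite /= -!catA.
Qed.

Lemma right_chains_reflection c l x r :
  right_chains (reflection c (Node l x r)) =
  right_chains (reflection c r) ++
  (rcons (head [::] (right_chains (reflection c l))) (c x)
     :: behead (right_chains (reflection c l))).
Proof. by rewrite /= right_chains_attachL right_chains_attachR. Qed.

(** Read backwards, the chains of the reflected left subtree come first, the last of them extended
    by the root, then those of the reflected right subtree: this is the in-order recursion. *)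
Lemma flatten_reflection c t :
  flatten (rev (right_chains (reflection c t))) = map c (inorder t).
Proof.
elim: t => // l IHl x r IHr.
rewrite right_chains_reflection rev_cat flatten_cat IHr /= map_cat /= -IHl.
rewrite rev_cons -cats1 flatten_cat /= cats0 -cat_rcons; congr (_ ++ _).
case: (right_chains _) => //= h q; rewrite rev_cons -[rcons (rev q) h]cats1.
by rewrite flatten_cat /= cats0 rcons_cat.
Qed.

Lemma map_reflection c t :
  right_chains (reflection c t) = map (map c) (right_chains (reflection id t)).
Proof.
elim: t => // l IHl x r IHr.
rewrite !right_chains_reflection IHl IHr map_cat /= map_rcons.
by case: (right_chains (reflection id l)).
Qed.

Lemma perm_reflection t :
  perm_eq (flatten (right_chains (reflection id t))) (preorder t).
Proof.
apply: perm_trans (perm_right_chains _) _.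
by rewrite preorder_reflection map_id perm_rev.
Qed.

Lemma mem_reflection t x :
  (x \in flatten (right_chains (reflection id t))) = (x \in preorder t).
Proof. exact/perm_mem/perm_reflection. Qed.

Lemma rev_subn_iota n : rev [seq n.+1 - i | i <- iota 1 n] = iota 1 n.
Proof.
apply: (@eq_from_nth _ 0); first by rewrite size_rev size_map.
move=> i; rewrite size_rev size_map size_iota => i_n.
rewrite nth_rev ?size_map ?size_iota// (nth_map 0) ?size_iota; last by lia.
by rewrite !nth_iota; lia.
Qed.

(** The reflected tree is again labelled in preorder, so cutting the word of its reversed chains at
    the descents returns these chains. *)
Lemma bar_phi n t : preorder t = iota 1 n ->
  bar n (phi t) = rev (right_chains (reflection (subn n.+1) t)).
Proof.
move=> pt; rewrite /bar /phi flatten_cut_descents -flatten_reflection.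
apply: (@preordered_cut_descents 1).
by rewrite /preordered preorder_reflection pt rev_subn_iota size_iota.
Qed.

(** * The complement blocks *)

(** For [P] an interval [(a, b]], some block obstructs the passage from [a°] to [b°]. *)
Definition splits (P : pred nat) (q : seq block) : bool :=
  has (fun b => has P b && has (predC P) b) q.

Definition same_block (q : seq block) (x y : nat) : bool :=
  has (fun b => (x \in b) && (y \in b)) q.

Lemma splits_const P (v : bool) q : {in flatten q, forall x, P x = v} ->
  splits P q = false.
Proof.
move=> Pv; apply/hasPn => b bq.
have Pb x : x \in b -> P x = v by move=> xb; apply: Pv; apply/flattenP; exists b.
apply/negP => /andP[/hasP[x xb Px] /hasP[y yb /= Py]].
by move: Py; rewrite (Pb y)// -(Pb x)// Px.
Qed.

Lemma eq_splits P P' q : {in flatten q, P =1 P'} -> splits P q = splits P' q.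
Proof.
move=> PP; apply: eq_in_has => b bq.
have Pb : {in b, P =1 P'} by move=> x xb; apply: PP; apply/flattenP; exists b.
by congr andb; apply: eq_in_has => // x xb /=; rewrite Pb.
Qed.

(** The root [x] joins the chain headed by [y]. If [P] separates [x] from [y], this chain is split;
    otherwise it is split exactly when it was before. *)
Lemma splits_node P l x r : splits P (right_chains (Node l x r)) =
  splits P (right_chains l) ||
  (if r is Node _ y _ then (P x != P y) || splits P (right_chains r) else false).
Proof.
case: r => [|l' y r'] /=; first by rewrite cats0 /splits /= !orbF; case: (P x).
rewrite /splits /= !has_cat.
by case: (P x); case: (P y); rewrite /= ?orbF ?orbT //= orbCA.
Qed.

Lemma same_blockNl q x y : x \notin flatten q -> same_block q x y = false.
Proof.
move=> xq; apply/hasPn => b bq; apply: contra xq => /andP[xb _].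
by apply/flattenP; exists b.
Qed.

Lemma same_blockC q x y : same_block q x y = same_block q y x.
Proof. by apply: eq_has => b; rewrite andbC. Qed.

Lemma same_blockNr q x y : y \notin flatten q -> same_block q x y = false.
Proof. by rewrite same_blockC; exact: same_blockNl. Qed.

Lemma same_block_rcons q z x y : x != z -> y != z ->
  same_block (rcons (head [::] q) z :: behead q) x y = same_block q x y.
Proof.
move=> /negbTE xz /negbTE yz; rewrite /same_block /= !mem_rcons !inE xz yz /=.
by case: q.
Qed.

Lemma same_block_last q z y : z \notin flatten q ->
  same_block (rcons (head [::] q) z :: behead q) z y =
  (y == z) || (y \in head [::] q).
Proof.
move=> zq; rewrite /same_block /= !mem_rcons !inE eqxx /=.
rewrite -/(same_block (behead q) z y) same_blockNl ?orbF//.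
apply: contra zq; rewrite -[in X in _ -> X]flatten_head_behead mem_cat => ->.
by rewrite orbT.
Qed.

(** The second claim feeds the induction: the root [k] joins the head block of the reflected left
    subtree, and on the labels of [l] the interval [(k, b]] amounts to [c <= b]. *)
Lemma reflection_blocks k t : preordered k t ->
  (forall a b, a \in preorder t -> b \in preorder t -> a <= b ->
     same_block (right_chains (reflection id t)) a b =
     ~~ splits (fun c => a < c <= b) (right_chains t)) /\
  (forall b, b \in preorder t ->
     (b \in head [::] (right_chains (reflection id t))) =
     ~~ splits (fun c => c <= b) (right_chains t)).
Proof.
elim: t k => [//|l IHl x r IHr] k /preordered_node[-> pl pr].
have [Pl Ql] := IHl _ pl; have [Pr Qr] := IHr _ pr.
have ml y : (y \in preorder l) = (k < y <= k + size (preorder l)).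
  by rewrite (mem_preordered _ pl); lia.
have mr y : (y \in preorder r) = (k + size (preorder l) < y
                      <= k + size (preorder l) + size (preorder r)).
  by rewrite (mem_preordered _ pr); lia.
have sl (P : pred nat) (v : bool) : {in preorder l, forall y, P y = v} ->
    splits P (right_chains l) = false.
  by move=> Pv; apply: (@splits_const _ v) => y; rewrite mem_right_chains; exact: Pv.
have sr (P : pred nat) (v : bool) : {in preorder r, forall y, P y = v} ->
    splits P (right_chains r) = false.
  by move=> Pv; apply: (@splits_const _ v) => y; rewrite mem_right_chains; exact: Pv.
have nr : 0 < size (preorder r) ->
    exists l' r', r = Node l' (k + size (preorder l)).+1 r'.
  by case: (r) pr => // l' y r' /preordered_node[-> _ _] _; exists l', r'; rewrite addSn.
(* The second disjunct of [splits_node]. The root of [r], if any, carries the first label after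
   those of [l]; whether [P] separates it from [k] decides between [rs1] and [rs2]. *)
pose right_splits (P : pred nat) :=
  if r is Node _ y _ then (P k != P y) || splits P (right_chains r) else false.
have rs1 (P : pred nat) : P (k + size (preorder l)).+1 = P k ->
    right_splits P = splits P (right_chains r).
  rewrite /right_splits; case: (posnP (size (preorder r))) => [|/nr[l' [r' ->]] -> //].
    by case: (r).
  by rewrite eqxx.
have rs2 (P : pred nat) : 0 < size (preorder r) ->
    P (k + size (preorder l)).+1 != P k -> right_splits P.
  by rewrite /right_splits eq_sym => /nr[l' [r' ->]] ->.
have rl : k \notin flatten (right_chains (reflection id l)).
  by rewrite mem_reflection ml; lia.
have rrx y : (y \in preorder r) = false ->
    y \notin flatten (right_chains (reflection id r)).
  by move=> yr; rewrite mem_reflection yr.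
have rlx y : (y \in preorder l) = false ->
    y \notin flatten (right_chains (reflection id l)).
  by move=> yl; rewrite mem_reflection yl.
have rlk y : y != k -> (y \in preorder l) = false ->
    y \notin flatten (rcons (head [::] (right_chains (reflection id l))) k
       :: behead (right_chains (reflection id l))).
  move=> yk /rlx; rewrite -flatten_head_behead /= !mem_cat mem_rcons inE.
  by rewrite (negbTE yk).
split.
  move=> a b; rewrite [preorder _]/= !inE !mem_cat !ml !mr => ak bk ab.
  rewrite right_chains_reflection splits_node -/(right_splits _).
  rewrite /same_block has_cat -!/(same_block _ a b).
  set P := (fun c => a < c <= b).
  (* Each of [a] and [b] is the root, in [l] or in [r]; three of the nine cases contradict [a <= b].
     If only [b] is in [r], then [(a, b]] contains the root of [r] but not [k], and these two share
     a chain. *)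
  case/or3P: ak => [/eqP ak|al|ar]; case/or3P: bk => [/eqP bk|bl|br];
    try lia.
  - rewrite [same_block _ a b]same_blockNl; last by apply: rrx; rewrite mr; lia.
    rewrite ak bk same_block_last// eqxx /=.
    rewrite (sl _ false) ?rs1 ?(sr _ false) /P //; try lia.
    by move=> y _; lia.
    by move=> y _; lia.
  - rewrite [same_block _ a b]same_blockNl; last by apply: rrx; rewrite mr; lia.
    rewrite ak same_block_last//= Ql ?ml// rs1 ?(sr _ false) /P; try lia.
      have -> : (b == k) = false by lia.
      rewrite /= orbF; congr negb; apply: eq_splits => y.
      by rewrite mem_right_chains ml; lia.
    by move=> y; rewrite mr; lia.
  - rewrite rs2 /P ?orbT; try lia.
    rewrite same_blockNl ?same_blockNr//; last by apply: rrx; rewrite mr; lia.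
    by apply: rlk; rewrite ?ml; lia.
  - rewrite [same_block _ a b]same_blockNl; last by apply: rrx; rewrite mr; lia.
    rewrite same_block_rcons ?Pl ?ml//=; try lia.
    rewrite rs1 ?(sr _ false) ?orbF /P //; try lia.
    by move=> y; rewrite mr; lia.
  - rewrite rs2 /P ?orbT; try lia.
    rewrite same_blockNl ?same_blockNr//; last by apply: rrx; rewrite mr; lia.
    by apply: rlk; rewrite ?ml; lia.
  - rewrite orbC same_blockNl; last by apply: rlk; rewrite ?ml; lia.
    rewrite Pr ?mr// rs1 ?(sl _ false) /P //; try lia.
    by move=> y; rewrite ml; lia.
move=> b; rewrite [preorder _]/= !inE !mem_cat ml mr => bk.
rewrite right_chains_reflection splits_node -/(right_splits _).
set P := (fun c => c <= b).
(* With [r] empty, the head block is that of the reflected [l] with [k] appended. Otherwise it is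
   that of the reflected [r], and for [b] outside [r] the condition [c <= b] separates [k] from the
   root of [r]. *)
have [r0|r0] := posnP (size (preorder r)).
  have rL : r = Leaf by case: (r) r0.
  have -> : right_splits P = false by rewrite /right_splits rL.
  rewrite {1}rL /= mem_rcons inE orbF.
  case/or3P: bk => [/eqP bk|bl|br].
  - rewrite bk eqxx /= (sl _ false)// /P => y; rewrite ml; lia.
  - by rewrite Ql ?ml//; have -> : (b == k) = false by lia.
  - by lia.
have hr : head [::] (right_chains (reflection id r) ++
    rcons (head [::] (right_chains (reflection id l))) k
    :: behead (right_chains (reflection id l))) =
    head [::] (right_chains (reflection id r)).
  by have := perm_size (perm_reflection r); case: (right_chains _) => //=; lia.
rewrite hr; case/or3P: bk => [/eqP bk|bl|br].
- rewrite rs2 /P ?orbT; try lia.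
  by apply/negP => /mem_head_flatten; apply/negP/rrx; rewrite mr; lia.
- rewrite rs2 /P ?orbT; try lia.
  by apply/negP => /mem_head_flatten; apply/negP/rrx; rewrite mr; lia.
- rewrite Qr ?mr// rs1 ?(sl _ true) /P //; try lia.
  by move=> y; rewrite ml; lia.
Qed.

(** * Regions of the disc *)

Section Geometry.
Variable R : realType.
Local Open Scope ring_scope.

Notation plane := (R^o * R^o)%type.

Definition angle (n k : nat) : R := k%:R * pi / n%:R.

(* Signed distance to the line through the circle points at angles [s] and [e],
   positive on the side of the arc from [s] to [e]. *)
Definition chord (s e : R) (z : plane) : R :=
  z.1 * cos ((s + e) / 2) - z.2 * sin ((s + e) / 2) - cos ((e - s) / 2).

Lemma circle_pointE n k :
  circle_point R n k = (cos (angle n k), - sin (angle n k)).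
Proof. by []. Qed.

(** The sign thus depends on whether [t] is within the half-width of the arc from its middle
    angle. *)
Lemma chord_circle (s e t : R) :
  chord s e (cos t, - sin t) = cos (t - (s + e) / 2) - cos ((e - s) / 2).
Proof. by rewrite /chord /= cosB mulNr opprK. Qed.

Lemma cos_lt_outside (h x : R) :
  0 <= h -> h < `|x| < pi *+ 2 - h -> cos x < cos h.
Proof.
move=> h0 /andP[hx xh].
have -> : cos x = cos `|x| by case: (ger0P x) => // _; rewrite cosN.
have [xpi|xpi] := leP `|x| pi.
  rewrite ltr_cos ?in_itv //= ?normr_ge0 ?h0//=.
  by rewrite (le_trans (ltW hx)).
(* Past [pi], the symmetric angle is back where [cos] decreases and still exceeds [h]. *)
have -> : cos `|x| = cos (pi *+ 2 - `|x|).
  by rewrite cosB cos2pi sin2pi mul1r mul0r addr0.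
rewrite ltr_cos ?in_itv /=; lra.
Qed.

Lemma cos_gt_inside (h x : R) :
  h <= pi -> `|x| < h -> cos h < cos x.
Proof.
move=> hpi xh.
have -> : cos x = cos `|x| by case: (ger0P x) => // _; rewrite cosN.
have x0 := normr_ge0 x.
rewrite ltr_cos ?in_itv /= ?x0 //; lra.
Qed.

Lemma ltr_angle n j k : (0 < n)%N -> (angle n j < angle n k) = (j < k)%N.
Proof.
move=> n0; rewrite /angle ltr_pM2r ?invr_gt0 ?ltr0n// ltr_pM2r ?pi_gt0//.
by rewrite ltr_nat.
Qed.

Lemma ler_angle n j k : (0 < n)%N -> (angle n j <= angle n k) = (j <= k)%N.
Proof. by move=> n0; rewrite leNgt ltr_angle// -leqNgt. Qed.

Lemma angle_ge0 n k : 0 <= angle n k.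
Proof. by rewrite /angle mulr_ge0// mulr_ge0// pi_ge0. Qed.

Lemma angle_lt2pi n k : (k < n.*2)%N -> angle n k < pi *+ 2.
Proof.
move=> kn; have n0 : (0 < n)%N by lia.
rewrite /angle ltr_pdivrMr ?ltr0n//.
have -> : (pi : R) *+ 2 * n%:R = n.*2%:R * pi.
  by rewrite -muln2 natrM mulr2n; ring.
by rewrite ltr_pM2r ?pi_gt0// ltr_nat.
Qed.

Lemma chord_gt0 n i j k : (0 < n)%N -> (k < n.*2)%N -> (j < i < k)%N ->
  0 < chord (angle n j) (angle n k) (circle_point R n i).
Proof.
move=> n0 kn /andP[ji ik]; rewrite circle_pointE chord_circle subr_gt0.
have := angle_lt2pi kn; have := angle_ge0 n j.
move: ji ik; rewrite -(ltr_angle _ _ n0) -(ltr_angle i _ n0) => *.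
by apply: cos_gt_inside; [lra | rewrite ltr_norml; apply/andP; split; lra].
Qed.

(** The case [j = k], where the line is a tangent, covers [a = b] in [chord_avoids_hulls]. *)
Lemma chord_lt0 n i j k : (0 < n)%N -> (k < n.*2)%N -> (i < n.*2)%N ->
  (j <= k)%N -> (i < j)%N || (k < i)%N ->
  chord (angle n j) (angle n k) (circle_point R n i) < 0.
Proof.
move=> n0 kn kin jk ijk; rewrite circle_pointE chord_circle subr_lt0.
have := angle_lt2pi kn; have := angle_lt2pi kin.
have := angle_ge0 n j; have := angle_ge0 n i.
move: jk ijk; rewrite -(ler_angle _ _ n0) -(ltr_angle i j n0).
rewrite -(ltr_angle k i n0) => jk ijk *.
apply: cos_lt_outside; first lra.
apply/andP; split.
  rewrite ltr_normr; case/orP: ijk => ijk; apply/orP; [right|left]; lra.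
by rewrite ltr_norml; apply/andP; split; lra.
Qed.

Lemma chord_left n j k : chord (angle n j) (angle n k) (circle_point R n j) = 0.
Proof.
rewrite circle_pointE chord_circle -(cosN ((_ - _) / 2)).
by rewrite (_ : angle n j - _ = - ((angle n k - angle n j) / 2)) ?subrr//; lra.
Qed.

Lemma chord_right n j k :
  chord (angle n j) (angle n k) (circle_point R n k) = 0.
Proof.
rewrite circle_pointE chord_circle.
by rewrite (_ : angle n k - _ = (angle n k - angle n j) / 2) ?subrr//; lra.
Qed.

(** * Segments, convex hulls and connected components *)

Local Open Scope convex_scope.

Lemma plane_convE (x y : convex_lmodType plane) (l : {i01 R}) :
  x <| l |> y = (l%:num * x.1 + (1 - l%:num) * y.1,
                 l%:num * x.2 + (1 - l%:num) * y.2).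
Proof. by []. Qed.

Lemma chord_conv (s e : R) (x y : convex_lmodType plane) (l : {i01 R}) :
  chord s e (x <| l |> y) = l%:num * chord s e x + (1 - l%:num) * chord s e y.
Proof. by rewrite plane_convE /chord /=; ring. Qed.

Lemma chord_continuous (s e : R) : continuous (chord s e).
Proof.
move=> z; rewrite /chord; apply: cvgB; last exact: cvg_cst.
by apply: cvgB; apply: cvgM; [exact: cvg_fst|exact: cvg_cst|
  exact: cvg_snd|exact: cvg_cst].
Qed.

Lemma convex_disc : convex_set (@disc R : set (convex_lmodType plane)).
Proof.
move=> x y l /set_mem xD /set_mem yD; apply: mem_set; move: xD yD.
rewrite plane_convE /disc /= => xD yD.
have l0 : 0 <= l%:num by [].
have l1 : l%:num <= 1 by [].
set a := l%:num in l0 l1 *.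
have h1 : 0 <= a * (1 - a) * ((x.1 - y.1) ^+ 2 + (x.2 - y.2) ^+ 2).
  by rewrite mulr_ge0 ?addr_ge0 ?sqr_ge0// mulr_ge0// subr_ge0.
have h2 : 0 <= a * (1 - (x.1 ^+ 2 + x.2 ^+ 2)) by rewrite mulr_ge0 ?subr_ge0.
have h3 : 0 <= (1 - a) * (1 - (y.1 ^+ 2 + y.2 ^+ 2)).
  by rewrite mulr_ge0 ?subr_ge0.
rewrite -subr_ge0.
have -> : 1 - ((a * x.1 + (1 - a) * y.1) ^+ 2 + (a * x.2 + (1 - a) * y.2) ^+ 2)
  = a * (1 - a) * ((x.1 - y.1) ^+ 2 + (x.2 - y.2) ^+ 2) +
   a * (1 - (x.1 ^+ 2 + x.2 ^+ 2)) + (1 - a) * (1 - (y.1 ^+ 2 + y.2 ^+ 2)).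
  by ring.
by rewrite !addr_ge0.
Qed.

Lemma circle_disc n k : disc (circle_point R n k).
Proof. by rewrite /disc circle_pointE /= sqrrN cos2Dsin2. Qed.

Lemma i01_exists (a : R) : 0 <= a <= 1 -> exists l : {i01 R}, l%:num = a.
Proof. by move=> /andP[a0 a1]; exists (Itv01 a0 a1). Qed.

(** In coordinates rotated by the middle angle [m], the point becomes [(cos h, w)], and membership
    in the disc bounds [w] by [sin h] in absolute value. *)
Lemma disc_chord n j k (z : plane) : (0 < n)%N -> (k < n.*2)%N -> (j < k)%N ->
  disc z -> chord (angle n j) (angle n k) z = 0 ->
  exists l : {i01 R}, z = (circle_point R n j : convex_lmodType plane)
                            <| l |> circle_point R n k.
Proof.
move=> n0 kn jk; rewrite /disc /= => zD.
rewrite !circle_pointE.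
pose m := (angle n j + angle n k) / 2; pose h := (angle n k - angle n j) / 2.
rewrite /chord -/m -/h => /eqP; rewrite subr_eq0 => /eqP zh.
have -> : angle n j = m - h by rewrite /m /h; lra.
have -> : angle n k = m + h by rewrite /m /h; lra.
have sh : 0 < sin h.
  have := angle_lt2pi kn; have := angle_ge0 n j.
  move: jk; rewrite -(ltr_angle _ _ n0) => *.
  by apply: sin_gt0_pi; rewrite /h; apply/andP; split; lra.
have cm : cos m ^+ 2 + sin m ^+ 2 = 1 := cos2Dsin2 m.
have ch : cos h ^+ 2 + sin h ^+ 2 = 1 := cos2Dsin2 h.
have [w wE] : exists w, w = z.1 * sin m + z.2 * cos m by eexists.
have wz : z.1 ^+ 2 + z.2 ^+ 2 = cos h ^+ 2 + w ^+ 2.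
  rewrite -zh wE -[LHS]mulr1 -cm; ring.
have wh : w ^+ 2 <= sin h ^+ 2 by lra.
have {wh} /andP[wl wr] : - sin h <= w <= sin h.
  rewrite -ler_norml -(@ler_pXn2r _ 2) ?nnegrE ?(ltW sh)//.
  by rewrite -normrX ger0_norm ?sqr_ge0.
(* The endpoints [j] and [k] have [w = sin h] and [w = - sin h], which determines the weight. *)
have [l lE] : exists l : {i01 R}, l%:num = (sin h + w) / (2 * sin h).
  apply: i01_exists; apply/andP; split; first by rewrite divr_ge0; lra.
  by rewrite ler_pdivrMr; lra.
exists l; rewrite plane_convE lE /=.
have sh0 : sin h != 0 by rewrite gt_eqF.
have zE1 : z.1 = cos h * cos m + w * sin m.
  rewrite -zh wE -[LHS]mulr1 -cm; ring.
have zE2 : z.2 = w * cos m - cos h * sin m.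
  rewrite -zh wE -[LHS]mulr1 -cm; ring.
rewrite !cosB !cosD !sinB !sinD.
clear zD zh wz wE; case: z zE1 zE2 => z1 z2 /= -> ->.
by congr pair; field.
Qed.


Lemma convex_hull_conv (A : set plane) (x y : plane) (l : {i01 R}) :
  A x -> A y ->
  convex_hull A ((x : convex_lmodType plane) <| l |> y).
Proof.
move=> Ax Ay M /= [Mc AM]; apply/set_mem/Mc; apply/mem_set; exact: AM.
Qed.

(** The set where the affine [f] is positive is convex and contains [A]. *)
Lemma halfplane_hull (A : set plane) (f : plane -> R) :
  (forall (x y : convex_lmodType plane) (l : {i01 R}),
     f (x <| l |> y) = l%:num * f x + (1 - l%:num) * f y) ->
  (forall z, A z -> 0 < f z) -> forall z, convex_hull A z -> 0 < f z.
Proof.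
move=> fE Af z; apply: (@smallest_sub _ _ _ [set z | 0 < f z]) => //.
move=> x y l /set_mem /= fx /set_mem /= fy; apply/mem_set => /=.
by rewrite fE; exact: (@convR_gt0 R (f x) (f y) l fx fy).
Qed.

(** The vertex [c] has circle index [2 * (c - 1)] and [a°] has index [2 * a - 1], so the vertices of
    [(a, b]] are exactly those on the arc from [a°] to [b°]. A block inside or outside this interval
    has its hull strictly on one side of the line. *)
Lemma chord_avoids_hulls n (q : seq block) a b (z : plane) :
  (forall B c, B \in q -> c \in B -> (0 < c <= n)%N) ->
  (0 < a <= b)%N -> (b <= n)%N -> ~~ splits (fun c => a < c <= b)%N q ->
  chord (angle n a.*2.-1) (angle n b.*2.-1) z = 0 ->
  ~ hulls n q z.
Proof.
move=> qn /andP[a0 ab] bn /hasPn /= nsep z0 [B /= Bq].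
have n0 : (0 < n)%N by lia.
have bn2 : (b.*2.-1 < n.*2)%N by lia.
have := nsep _ Bq; rewrite negb_and => /orP[/hasPn Bout|/hasPn Bin] zB.
  suff : 0 < - chord (angle n a.*2.-1) (angle n b.*2.-1) z.
    by rewrite z0 oppr0 ltxx.
  move: zB.
  apply: (@halfplane_hull _ (fun z =>
    - chord (angle n a.*2.-1) (angle n b.*2.-1) z)) => [x y l|_ [c /= cB <-]].
    by rewrite chord_conv opprD !mulrN.
  have := Bout _ cB; have := qn _ _ Bq cB => cn cab.
  by rewrite oppr_gt0; apply: chord_lt0 => //; lia.
suff : 0 < chord (angle n a.*2.-1) (angle n b.*2.-1) z by rewrite z0 ltxx.
move: zB; apply: (@halfplane_hull _
  (chord (angle n a.*2.-1) (angle n b.*2.-1))) => [x y l|_ [c /= cB <-]].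
  exact: chord_conv.
have := Bin _ cB; have := qn _ _ Bq cB; rewrite negbK => cn cab.
by apply: chord_gt0 => //; lia.
Qed.

Lemma segment_connected_plane (x y : plane) :
  connected [set (x : convex_lmodType plane) <| l |> y | l in [set: {i01 R}]].
Proof.
pose g (t : R) : plane := (t * x.1 + (1 - t) * y.1, t * x.2 + (1 - t) * y.2).
have -> : [set (x : convex_lmodType plane) <| l |> y | l in [set: {i01 R}]]
  = g @` `[0, 1].
  apply/seteqP; split => [_ [l _ <-]|_ [t /= t01 <-]].
    by exists l%:num => //=; rewrite in_itv /=; apply/andP; split.
  have [|l lt] := @i01_exists t; first by rewrite in_itv in t01.
  by exists l => //; rewrite plane_convE lt.
apply: connected_continuous_connected; first exact: segment_connected.
apply: continuous_subspaceT => t.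
have lin (c d : R^o) : (s * c + (1 - s) * d : R^o) @[s --> t] -->
    (t * c + (1 - t) * d : R^o).
  apply: cvgD; apply: cvgM; try exact: cvg_cst; first exact: cvg_id.
  by apply: cvgB; [exact: cvg_cst|exact: cvg_id].
exact: (@cvg_pair _ _ _ _ (nbhs (t * x.1 + (1 - t) * y.1 : R^o))
  (nbhs (t * x.2 + (1 - t) * y.2 : R^o)) _ _ _ _ _ (lin _ _) (lin _ _)).
Qed.

Lemma connected_component_splits n (q : seq block) a b :
  (forall B c, B \in q -> c \in B -> (0 < c <= n)%N) ->
  (0 < a <= b)%N -> (b <= n)%N ->
  connected_component (@disc R `\` hulls n q)
    (circle_point R n a.*2.-1) (circle_point R n b.*2.-1) <->
  ~~ splits (fun c => a < c <= b)%N q.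
Proof.
move=> qn ab bn; split; last first.
  move=> nsep.
  exists [set (circle_point R n a.*2.-1 : convex_lmodType plane) <| l |>
          circle_point R n b.*2.-1 | l in [set: {i01 R}]].
    split; last exact: segment_connected_plane.
      by exists 1%:i01 => //; rewrite conv1.
    move=> _ [l _ <-]; split.
      by apply/set_mem/convex_disc; apply/mem_set; exact: circle_disc.
    apply: (chord_avoids_hulls qn ab bn nsep).
    by rewrite chord_conv chord_left chord_right !mulr0 addr0.
  by exists 0%:i01 => //; rewrite conv0.
move=> [C [Ca CD Cc] Cb]; apply/hasPn => B Bq.
apply/negP => /andP[/hasP[c cB /= cab] /hasP[d dB /= dab]].
(* Along a connected set joining [a°] to [b°], the chord function of [j] and [k] changes sign, so it
   vanishes at a point of the disc; that point lies on the segment between the two vertices, inside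
   the hull of [B]. *)
have sep j k : (j \in B) -> (k \in B) -> (j < k)%N ->
    (a < j <= b)%N != (a < k <= b)%N -> False.
  move=> jB kB jk ajk.
  have j1 := qn _ _ Bq jB; have k1 := qn _ _ Bq kB.
  have n0 : (0 < n)%N by lia.
  have kn : (k.-1.*2 < n.*2)%N by lia.
  pose f := @chord (angle n j.-1.*2) (angle n k.-1.*2).
  have : connected (f @` C).
    apply: connected_continuous_connected => //.
    by apply: continuous_subspaceT; exact: chord_continuous.
  move/connected_intervalP => fC.
  have [z Cz fz0] : (f @` C) 0.
    have Fa : (f @` C) (f (circle_point R n a.*2.-1)).
      by exists (circle_point R n a.*2.-1).
    have Fb : (f @` C) (f (circle_point R n b.*2.-1)).
      by exists (circle_point R n b.*2.-1).
    (* Exactly one of the two points is on the arc from [j] to [k]: [b°] when [a < j <= b < k], and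
       [a°] when [j <= a < k <= b]. *)
    have [aj|aj] := boolP (a < j)%N.
      have fa : f (circle_point R n a.*2.-1) < 0 by apply: chord_lt0 => //; lia.
      have fb : 0 < f (circle_point R n b.*2.-1) by apply: chord_gt0 => //; lia.
      by apply: (fC _ _ Fa Fb); rewrite !ltW.
    have fa : 0 < f (circle_point R n a.*2.-1) by apply: chord_gt0 => //; lia.
    have fb : f (circle_point R n b.*2.-1) < 0 by apply: chord_lt0 => //; lia.
    by apply: (fC _ _ Fb Fa); rewrite !ltW.
  have [zD zH] := CD _ Cz; apply: zH.
  have [|l zE] := disc_chord n0 kn _ zD fz0; first by lia.
  exists B => //; rewrite zE; apply: convex_hull_conv; [by exists j|by exists k].
have [cd|dc|cd] := ltngtP c d.
- by apply: (sep c d) => //; rewrite cab (negbTE dab).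
- by apply: (sep d c) => //; rewrite cab (negbTE dab).
- by move: dab; rewrite -cd cab.
Qed.

Lemma same_region_splits n (q : seq block) i j :
  (forall B c, B \in q -> c \in B -> (0 < c <= n)%N) ->
  (0 < i <= n)%N -> (0 < j <= n)%N ->
  same_region R n q i j <->
  ~~ splits (fun c => n.+1 - maxn i j < c <= n.+1 - minn i j)%N q.
Proof.
move=> qn i1 j1.
(* The point [k'] is [a°] for [a = n + 1 - k]; this reverses the order, hence the exchange of [minn]
   and [maxn]. *)
have pE k : (0 < k <= n)%N ->
    primed_vertex R n k = circle_point R n (n.+1 - k).*2.-1.
  by move=> k1; rewrite /primed_vertex; congr circle_point; lia.
rewrite /same_region !pE// -(connected_component_splits qn); try lia.
have [ij|ji] := leqP i j; last by [].
by split; exact: connected_component_sym.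
Qed.

End Geometry.

(** * Regions as blocks of the reflection, and the commutative square *)

Lemma same_block_complement n t i j : preordered 1 t ->
  size (preorder t) = n -> 0 < i <= n -> 0 < j <= n ->
  same_block (right_chains (reflection (subn n.+1) t)) i j =
  ~~ splits (fun c => n.+1 - maxn i j < c <= n.+1 - minn i j) (right_chains t).
Proof.
move=> pt tn i1 j1.
have tm x : (x \in preorder t) = (0 < x <= n).
  by rewrite (mem_preordered _ pt) tn; lia.
have -> : same_block (right_chains (reflection (subn n.+1) t)) i j =
    same_block (right_chains (reflection id t)) (n.+1 - i) (n.+1 - j).
  rewrite map_reflection /same_block has_map; apply: eq_in_has => b bt /=.
  have mapb x : 0 < x <= n -> (x \in map (subn n.+1) b) = (n.+1 - x \in b).
    move=> x1; apply/mapP/idP => [[y yb xE]|xb]; last by exists (n.+1 - x) => //; lia.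
    have : y \in preorder t by rewrite -mem_reflection; apply/flattenP; exists b.
    by rewrite tm => y1; rewrite xE (_ : n.+1 - _ = y)//; lia.
  by rewrite !mapb.
have [K _] := reflection_blocks pt.
have [ij|ji] := leqP i j; last by rewrite K ?tm //; lia.
by rewrite same_blockC K ?tm //; lia.
Qed.

Lemma alpha'_psi (R : realType) n t : preorder t = iota 1 n ->
  alpha' R n (psi t) = rev (right_chains (reflection (subn n.+1) t)).
Proof.
move=> tE; have tn : size (preorder t) = n by rewrite tE size_iota.
have pt : preordered 1 t by rewrite /preordered tn.
set t' := reflection _ t.
have t'E : preorder t' = iota 1 n by rewrite preorder_reflection tE rev_subn_iota.
have pt' : preordered 1 t' by rewrite /preordered t'E size_iota.
have m't x : (x \in flatten (right_chains t')) = (0 < x <= n).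
  by rewrite mem_right_chains t'E mem_iota; lia.
have ut' : uniq (flatten (right_chains t')).
  by rewrite (perm_uniq (perm_right_chains t')) t'E iota_uniq.
have region i j : 0 < i <= n -> 0 < j <= n ->
    `[< same_region R n (psi t) i j >] = same_block (right_chains t') i j.
  move=> i1 j1; rewrite same_block_complement//; apply/asboolP/idP; last first.
    move=> nsp; apply/same_region_splits => //; last first.
      by rewrite (preordered_psi pt) /splits has_rev.
    move=> B c; rewrite (preordered_psi pt) mem_rev => Bt cB.
    have : c \in preorder t by rewrite -mem_right_chains; apply/flattenP; exists B.
    by rewrite (mem_preordered _ pt) tn; lia.
  move/same_region_splits; rewrite (preordered_psi pt) /splits has_rev; apply => //.
  move=> B c; rewrite mem_rev => Bt cB.
  have : c \in preorder t by rewrite -mem_right_chains; apply/flattenP; exists B.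
  by rewrite (mem_preordered _ pt) tn; lia.
(* The class of [i] and its block in [t'] are increasing lists with the same members. *)
have class b i : b \in right_chains t' -> i \in b ->
    [seq j <- iota 1 n | `[< same_region R n (psi t) i j >]] = b.
  move=> bt ib.
  have bn x : x \in b -> 0 < x <= n.
    by move=> xb; rewrite -m't; apply/flattenP; exists b.
  apply: (irr_sorted_eq ltn_trans ltnn).
  - by apply: sorted_filter; [exact: ltn_trans|exact: iota_ltn_sorted].
  - exact: sorted_right_chain pt' bt.
  - move=> j; rewrite mem_filter mem_iota; apply/andP/idP => [[ij j1]|jb].
      move: ij; rewrite region; [|exact: bn|by lia].
      case/hasP=> b' b't /andP[ib' jb'].
      by rewrite (uniq_flatten_inj ut' bt b't ib ib').
    have := bn _ jb => j1; split; last by lia.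
    by rewrite region ?bn//; apply/hasP; exists b => //; rewrite ib jb.
apply: canonical_order_eq; first exact: undup_uniq.
  exact: sorted_rev_right_chains pt'.
move=> b; rewrite mem_undup mem_rev; apply/mapP/idP => [[i]|bt].
  rewrite mem_iota add1n ltnS -m't => /flattenP[b' b't ib'] ->.
  by rewrite (class b').
have : b != [::] by apply/eqP; exact: right_chains_neq0 bt.
case: b bt => // i b bt _; exists i; last by rewrite (class (i :: b)) ?mem_head.
rewrite mem_iota add1n ltnS -m't; apply/flattenP; exists (i :: b) => //.
exact: mem_head.
Qed.

Theorem proposition3p36 (R : realType) (n : nat) (p : seq block) :
  (0 < n)%N ->
  NCCP_avoiding n [:: 3; 1; 2] p ->
  psi_phi_inv n (alpha n p) = bar n p /\
  bar n p = alpha' R n (psi_phi_inv n p).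
Proof.
move=> _ [/NCCP_phi[t [[pit it] tp <-]] av].
rewrite /phi flatten_cut_descents -/(phi t) in av.
have tE : preorder t = iota 1 n.
  rewrite (avoids_preordered pit it av).
  by rewrite -(perm_size (perm_inorder_preorder t)) (perm_size pit) size_iota.
rewrite bar_phi// /psi_phi_inv /= phi_invK//; split; last by rewrite alpha'_psi.
rewrite /alpha bar_phi// /phi_psi_inv -[LHS]/(psi_phi_inv n _).
set t' := reflection _ t.
have t'E : preorder t' = iota 1 n by rewrite preorder_reflection tE rev_subn_iota.
(* The partial inverse is a right inverse on the image of the 312-avoiding partitions, and [phi t']
   shows that the bar belongs to this image. *)
apply: pinvK; rewrite inE; exists (phi t'); first exact: phi_NCCP_avoiding.
rewrite /psi_phi_inv /= phi_invK; last exact: preordered_labeled.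
by apply: (@preordered_psi 1); rewrite /preordered t'E size_iota.
Qed.
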